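(* Let $(X,d)$ be a nonempty compact metric space, let $\lambda$ be the Banach-Mycielski content on $X$ (with respect to a non-principal ultrafilter $\mathcal F$ on the positive integers) and let $\mu$ be the associated Banach-Mycielski measure. Then $X$ is regular (i.e. $\mathrm{sing}(F)=0$ for every closed $F\subset X$) if and only if $\mu(F)=\lambda(F)$ for every closed set $F\subset X$.
   Context: For compact $C\subset X$ and $t\in(0,1]$, $E(C,t)$ is the minimal cardinality of a covering of $C$ by sets all of diameter less than $t$. For a non-principal ultrafilter $\mathcal F$ on the positive integers, the Banach-Mycielski content of a compact $K\subset X$ is $\lambda(K)=\lim_{n\to\mathcal F} E(K,\frac1n)/E(X,\frac1n)$ (ultrafilter limit in $[0,\infty]$). For $U\subset X$ open put $\mu_0(U)=\sup\{\lambda(K):K\subset U,\ K \text{ closed}\}$, and for $A\subset X$ put $\mu^*(A)=\inf\{\mu_0(U):A\subset U,\ U\text{ open}\}$; $\mu^*$ is an outer measure, and the Borel probability measure $\mu$ obtained from it by Carathéodory's theorem (the restriction of $\mu^*$ to Borel sets) is the Banach-Mycielski measure. For closed $F\subset X$ let $\overline{K(F,\frac1n)}=\{x\in X:d(x,F)\le\frac1n\}$, with $d(x,F)=\inf_{y\in F}d(x,y)$, and define the singularity $\mathrm{sing}(F)=\lim_{n\to\infty}\lambda(\overline{K(F,\frac1n)})-\lambda(F)$. *)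

(* Defs.v *)
From HB Require Import structures.
From mathcomp Require Import all_boot all_order all_algebra finmap lra.
From mathcomp Require Import all_classical all_reals all_analysis.

Set Implicit Arguments.
Unset Strict Implicit.
Unset Printing Implicit Defensive.

Import Order.TTheory GRing.Theory Num.Theory.
Import numFieldNormedType.Exports.

Local Open Scope classical_set_scope.
Local Open Scope ring_scope.

(* Nonempty metric spaces: a measurableType has to be pointed. *)
#[short(type="pmetricType")]
HB.structure Definition PointedMetric (K : numDomainType) :=
  {M of Metric K M & Pointed M}.

Section definitions.
Context {R : realType} {X : pmetricType R}.
Local Open Scope ereal_scope.
Implicit Types (A C K U : set X) (x : X) (t r : R).

(* The diameter of the empty set is -oo here, so that, as usual, the empty set
   has diameter less than any t > 0. *)
Definition diam A : \bar R :=
  ereal_sup [set (mdist xy.1 xy.2)%:E | xy in A `*` A].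

Definition is_cover C t (S : {fset (set X)}) : Prop :=
  (forall U, U \in S -> diam U < t%:E) /\ C `<=` \bigcup_(U in [set` S]) U.

(* The value is +oo when there is no finite covering. *)
Definition covnum C t : \bar R :=
  ereal_inf [set (#|` S|%:R)%:E | S in is_cover C t].

(* An ultrafilter on the positive integers is encoded as an ultrafilter F on
   nat through the bijection n |-> n.+1. *)
Definition bm_content (F : set_system nat) K : \bar R :=
  lim ((fun n => covnum K n.+1%:R^-1 / covnum setT n.+1%:R^-1) @ F).

Definition bm_inner (F : set_system nat) U : \bar R :=
  ereal_sup [set bm_content F K | K in [set K | closed K /\ K `<=` U]].

Definition bm_outer (F : set_system nat) A : \bar R :=
  ereal_inf [set bm_inner F U | U in [set U | open U /\ A `<=` U]].

(* dist_to x set0 = +oo, hence closed_thickening set0 r = set0. *)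
Definition dist_to x A : \bar R := ereal_inf [set (mdist x y)%:E | y in A].

Definition closed_thickening A r : set X := [set x | dist_to x A <= r%:E].

Definition singularity (F : set_system nat) A : \bar R :=
  limn (fun n => bm_content F (closed_thickening A n.+1%:R^-1))
  - bm_content F A.

Definition bm_regular (F : set_system nat) : Prop :=
  forall A, closed A -> singularity F A = 0.

Definition nonprincipal (F : set_system nat) : Prop :=
  forall n, F <> principal_filter n.

End definitions.

Section coverings.
Context {R : realType} {X : pmetricType R}.
Context (cX : compact [set: X]).
Local Open Scope ereal_scope.
Implicit Types (C D K L U : set X) (t : R) (S : {fset (set X)}).

Lemma covnum_le C t S : is_cover C t S -> covnum C t <= (#|` S|%:R)%:E.
Proof. by move=> CS; apply: ereal_inf_lbound; exists S. Qed.

Lemma covnum_ge0 C t : 0 <= covnum C t.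
Proof. by apply: le_ereal_inf_tmp => _ [S _ <-]; rewrite lee_fin. Qed.

Lemma is_coverS C D t S : C `<=` D -> is_cover D t S -> is_cover C t S.
Proof. by move=> CD [? DS]; split => //; exact: subset_trans DS. Qed.

Lemma diam_ball (x : X) (e : R) : diam (ball x e) <= (e + e)%:E.
Proof.
apply: ge_ereal_sup => _ [[y z] /= [xy xz] <-]; rewrite lee_fin.
move: xy xz; rewrite !ballEmdist /= => xy xz.
by rewrite (le_trans (metric_triangle y x z))// metric_sym lerD// ltW.
Qed.

Lemma is_cover_ex C t : (0 < t)%R -> exists S, is_cover C t S.
Proof.
move=> t0; have := cX; rewrite compact_cover.
have e0 : (0 < t / 3)%R by rewrite divr_gt0.
move=> /(_ X setT (fun x => (ball x (t / 3))^°)).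
case.
- by move=> x _; exact: open_interior.
- by move=> x _; exists x => //; apply: nbhsx_ballx.
move=> I _ IX; exists [fset ball x (t / 3) | x in I]%fset; split.
- move=> U /imfsetP[x _ ->]; apply: le_lt_trans (diam_ball _ _) _.
  by rewrite lte_fin; lra.
- move=> x _; have [y Iy /interior_subset xy] := IX x Logic.I.
  by exists (ball y (t / 3)) => //=; apply/imfsetP; exists y.
Qed.

Lemma covnum_witness C t : (0 < t)%R ->
  exists2 S, is_cover C t S & covnum C t = (#|` S|%:R)%:E.
Proof.
move=> t0; have [S0 CS0] := is_cover_ex C t0.
pose P n := `[< exists2 S, is_cover C t S & #|` S| = n >].
have exP : exists n, P n by exists #|` S0|; apply/asboolP; exists S0.
case: (ex_minnP exP) => n /asboolP[S CS Sn] nmin.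
exists S => //; apply/eqP; rewrite eq_le covnum_le//=.
apply: le_ereal_inf_tmp => _ [S' CS' <-]; rewrite lee_fin ler_nat Sn.
by apply: nmin; apply/asboolP; exists S'.
Qed.

Lemma covnum_fin C t : (0 < t)%R -> covnum C t \is a fin_num.
Proof. by move=> /(covnum_witness C)[S _ ->]. Qed.

Lemma le_covnum C D t : C `<=` D -> covnum C t <= covnum D t.
Proof.
move=> CD; apply: le_ereal_inf_tmp => _ [S DS <-].
by apply: covnum_le; exact: is_coverS DS.
Qed.

Lemma covnumU C D t : (0 < t)%R ->
  covnum (C `|` D) t <= covnum C t + covnum D t.
Proof.
move=> t0; have [S CS ->] := covnum_witness C t0.
have [S' DS' ->] := covnum_witness D t0.
apply: (@le_trans _ _ (#|` (S `|` S')%fset|%:R)%:E).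
  apply: covnum_le; split=> [U|x].
    by rewrite inE => /orP[]; [exact: CS.1|exact: DS'.1].
  case=> [/CS.2|/DS'.2] [U /= US Ux]; exists U => //=; rewrite inE US ?orbT//.
by rewrite -EFinD lee_fin -natrD ler_nat cardfsU leq_subr.
Qed.

Lemma covnum_sep C D t : (0 < t)%R ->
  (forall x y, C x -> D y -> (t <= mdist x y)%R) ->
  covnum C t + covnum D t <= covnum (C `|` D) t.
Proof.
move=> t0 CD; have [S [Sd CDS] ->] := covnum_witness (C `|` D) t0.
pose SC := [fset U in S | `[< U `&` C !=set0 >]]%fset.
pose SD := [fset U in S | `[< U `&` D !=set0 >]]%fset.
have CSC : is_cover C t SC.
  split=> [U|x Cx]; first by rewrite !inE => /andP[/Sd].
  have [|U US Ux] := CDS x; first by left.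
  exists U => //=; rewrite !inE; apply/andP; split => //.
  by apply/asboolP; exists x.
have DSD : is_cover D t SD.
  split=> [U|x Dx]; first by rewrite !inE => /andP[/Sd].
  have [|U US Ux] := CDS x; first by right.
  exists U => //=; rewrite !inE; apply/andP; split => //.
  by apply/asboolP; exists x.
apply: le_trans (leeD (covnum_le CSC) (covnum_le DSD)) _.
rewrite -EFinD lee_fin -natrD ler_nat.
have dis : (SC `&` SD = fset0)%fset.
  apply/eqP; apply/fset0Pn => -[U]; rewrite !inE.
  move=> /andP[/andP[US /asboolP[x [Ux Cx]]] /andP[_ /asboolP[y [Uy Dy]]]].
  have := Sd _ US; rewrite ltNge => /negP; apply.
  apply: (@le_trans _ _ (mdist x y)%:E); first by rewrite lee_fin CD.
  by apply: ereal_sup_ubound; exists (x, y).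
rewrite -[leqLHS]subn0 -(cardfs0 (set X)) -dis -cardfsU.
apply: fsubset_leq_card; apply/fsubsetP => U.
by rewrite !inE => /orP[] /andP[].
Qed.

Lemma covnum0 t : (0 < t)%R -> covnum (@set0 X) t = 0.
Proof.
move=> t0; apply/eqP; rewrite eq_le covnum_ge0 andbT.
have := @covnum_le (@set0 X) t fset0; rewrite cardfs0; apply.
by split => //= U; rewrite inE.
Qed.

Lemma covnumT_gt0 t : (0 < t)%R -> 0 < covnum [set: X] t.
Proof.
move=> t0; have [S [_ TS] ->] := covnum_witness setT t0.
rewrite lte_fin ltr0n cardfs_gt0; apply/fset0Pn.
by have [U US _] := TS point Logic.I; exists U.
Qed.

End coverings.

Section ultrafilter_limits.
Context {R : realType} (F : set_system nat) (FU : UltraFilter F).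
Local Open Scope ereal_scope.

Lemma ultra_cvg01 (u : nat -> R) : (forall n, 0 <= u n <= 1)%R ->
  exists l : R, u @ F --> l.
Proof.
move=> u01; have /(_ (u @ F) _) : compact `[0%R, 1%R : R]%classic.
  exact: segment_compact.
case=> [|l [_ ul]].
  rewrite /fmap/=; apply: filterS filterT => n _ /=; rewrite in_itv/=; exact: u01.
exists l => A lA; rewrite /fmap/=.
have [//|FnA] := in_ultra_setVsetC (u @^-1` A) FU.
by have [x [/= nAx Ax]] := ul (~` A) A FnA lA.
Qed.

Lemma ultra_ge N : nonprincipal F -> F [set n | (N <= n)%N].
Proof.
move=> Fnp; have FPF := @ultra_proper _ _ FU.
elim: N => [|N IH]; first by apply: filterS filterT.
have [FN|FnN] := in_ultra_setVsetC [set N] FU.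
  exfalso; apply: (Fnp N); symmetry; apply/esym.
  have PU := principal_filter_ultra N.
  apply: (@max_filter _ _ PU) => A /principal_filterP AN.
  by apply: filterS FN => _ ->.
apply: filterS2 IH FnN => n /= Nn /eqP nN.
by rewrite ltn_neqAle Nn andbT eq_sym.
Qed.

End ultrafilter_limits.

Section metric_separation.
Context {R : realType} {X : pmetricType R}.
Implicit Types (K L U : set X).

Lemma closed_inner U (e : R) : closed [set y : X | ball y e `<=` U].
Proof.
rewrite -(setCK [set y | _]); apply: open_closedC.
have -> : ~` [set y : X | ball y e `<=` U] = \bigcup_(z in ~` U) [set y | (mdist z y < e)%R].
  apply/seteqP; split=> [y /= /existsNP[z /not_implyP[yz Uz]]|y [z Uz /= zy] yU].
    by exists z => //=; move: yz; rewrite ballEmdist/= metric_sym.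
  by apply: Uz; apply: yU; rewrite ballEmdist/= metric_sym.
apply: bigcup_open => z _; rewrite openE => y /= zy.
apply/nbhs_ballP; exists (e - mdist z y)%R => /=; first by rewrite subr_gt0.
move=> w /=; rewrite ballEmdist/= ltrBrDl => yw.
exact: le_lt_trans (metric_triangle z y w) _.
Qed.

Lemma compact_inner_cover K (U : (set X)^nat) : compact K ->
  (forall i, open (U i)) -> K `<=` \bigcup_i U i ->
  exists n, exists2 e : R, 0 < e &
    forall x, K x -> exists2 i, (i < n)%N & ball x e `<=` U i.
Proof.
move=> /compact_near_coveringP cK oU KU.
have := cK (nat * R)%type (filter_prod \oo (0^'+)) 
  (fun ne x => 0 < ne.2 /\ exists2 i, (i < ne.1)%N & ball x ne.2 `<=` U i).
case.
  move=> x /KU[i _ Uix].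
  have [r /= r0 xr] : exists2 r : R, 0 < r & ball x r `<=` U i.
    by have := oU i; rewrite openE => /(_ x Uix)/nbhs_ballP[r /= r0 ?]; exists r.
  have r20 : 0 < r / 2 by rewrite divr_gt0.
  exists (ball x (r / 2), [set ne | (i < ne.1)%N /\ 0 < ne.2 < r / 2]).
    split; first exact: nbhsx_ballx.
    exists ([set n | (i < n)%N], [set e | 0 < e < r / 2]) => /=.
      split; first by exists i.+1.
      near=> e => /=; apply/andP; split; near: e.
        exact: nbhs_right_gt.
      exact: nbhs_right_lt.
    by move=> [n e] /= [? ?].
  move=> [y [n e]] /= [xy [ni /andP[e0 er]]]; split=> //; exists i => //.
  move=> z yz; apply: xr; rewrite (splitr r).
  by apply: ball_triangle xy _; exact: le_ball (ltW er) _ yz.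
move=> [A B] /= [[N _ AN] B0] AB.
have [e e0 Be] : exists2 e : R, 0 < e & B e.
  have : \forall e \near 0^'+, 0 < e /\ B e.
    by near=> e; split; near: e => //; exact: nbhs_right_gt.
  by move=> /filter_ex[e []]; exists e.
exists N, e => // x Kx.
by have [] := AB (N, e) (conj (AN N (leqnn N)) Be) x Kx.
Unshelve. all: by end_near. Qed.

Lemma compact_sep K L : compact K -> closed L -> K `&` L = set0 ->
  exists2 e : R, 0 < e & forall x y, K x -> L y -> e <= mdist x y.
Proof.
move=> cK cL KL0.
have [|x Kx|n [e e0 H]] := @compact_inner_cover K (fun=> ~` L) cK.
- by move=> _; exact: closed_openC.
- by exists 0%N => // Lx; rewrite -[False]/(set0 x) -KL0.
exists e => // x y Kx Ly; rewrite leNgt; apply/negP => xy.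
by have [_ _ /(_ y)] := H x Kx; rewrite ballEmdist; exact.
Qed.

End metric_separation.

Section content.
Context {R : realType} {X : pmetricType R} (F : set_system nat).
Context (cX : compact [set: X]).
Context (FU : UltraFilter F).
Context (Fnp : nonprincipal F).
Local Open Scope ereal_scope.
Implicit Types (K L U : set X).

Let ratio K n : \bar R := covnum K n.+1%:R^-1 / covnum [set: X] n.+1%:R^-1.

Let tn_gt0 n : (0 < n.+1%:R^-1 :> R)%R. Proof. by rewrite invr_gt0. Qed.

Let den n : exists2 c : R, (0 < c)%R & covnum [set: X] n.+1%:R^-1 = c%:E.
Proof.
have := covnum_fin cX setT (tn_gt0 n); have := covnumT_gt0 cX (tn_gt0 n).
by case: (covnum _ _) => // c c0 _; exists c.
Qed.

Let rat_ge0 K n : 0 <= ratio K n.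
Proof.
rewrite /ratio; have [c c0 ->] := den n.
by rewrite inver gt_eqF// mule_ge0 ?covnum_ge0// lee_fin invr_ge0 ltW.
Qed.

Let le_rat K L n : K `<=` L -> ratio K n <= ratio L n.
Proof.
move=> KL; rewrite /ratio; have [c c0 ->] := den n.
by rewrite inver gt_eqF// lee_wpmul2r ?le_covnum// lee_fin invr_ge0 ltW.
Qed.

Let ratT n : ratio setT n = 1.
Proof.
by rewrite /ratio; have [c c0 ->] := den n; rewrite inver gt_eqF// -EFinM divff// gt_eqF.
Qed.

Let rat_le1 K n : ratio K n <= 1.
Proof. by rewrite -(ratT n) le_rat. Qed.

Let rat_fin K n : ratio K n \is a fin_num.
Proof. by rewrite ge0_fin_numE// (le_lt_trans (rat_le1 K n)) ?ltry. Qed.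

Let rat_cvg K : exists l : R, ratio K n @[n --> F] --> l%:E.
Proof.
have [|l ul] := @ultra_cvg01 R F FU (fine \o ratio K).
  by move=> n /=; rewrite fine_ge0//= -lee_fin fineK.
exists l; have -> : ratio K = EFin \o (fine \o ratio K).
  by apply/funext => n /=; rewrite fineK.
exact: (cvg_comp _ _ ul).
Qed.

Let bm_cvg K : ratio K n @[n --> F] --> bm_content F K.
Proof.
have [l Kl] := rat_cvg K; rewrite /bm_content.
have -> : lim (ratio K n @[n --> F]) = l%:E by apply/cvg_lim.
exact: Kl.
Qed.

Let cvgF_ge (a l : \bar R) (u : nat -> \bar R) :
  u n @[n --> F] --> l -> F [set n | a <= u n] -> a <= l.
Proof. by move=> ul au; exact: cvge_ge au ul. Qed.

Lemma bm_content_fin K : bm_content F K \is a fin_num.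
Proof.
by have [l Kl] := rat_cvg K; rewrite (_ : bm_content F K = l%:E)//; apply/cvg_lim.
Qed.

Lemma bm_content_ge0 K : 0 <= bm_content F K.
Proof.
by apply: (cvgF_ge (@bm_cvg K)); apply: filterS filterT => n _; exact: rat_ge0.
Qed.

Lemma bm_contentT : bm_content F [set: X] = 1.
Proof.
apply/cvg_lim => //; rewrite [X in X @ _](_ : _ = fun=> (1 : \bar R)); last first.
  by apply/funext => n; exact: ratT.
exact: cvg_cst.
Qed.

Lemma bm_content0 : bm_content F (@set0 X) = 0.
Proof.
apply/cvg_lim => //; rewrite [X in X @ _](_ : _ = fun=> (0 : \bar R)); last first.
  by apply/funext => n; rewrite covnum0// mul0e.
exact: cvg_cst.
Qed.

Lemma le_bm_content K L : K `<=` L -> bm_content F K <= bm_content F L.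
Proof.
move=> KL; rewrite -subre_ge0 ?bm_content_fin//.
have : ratio L n - ratio K n @[n --> F] --> bm_content F L - bm_content F K.
  apply: cvgeB (@bm_cvg L) (@bm_cvg K).
  by rewrite fin_num_adde_defl// fin_numN bm_content_fin.
move/cvgF_ge; apply; apply: filterS filterT => n _.
by rewrite /= subre_ge0// le_rat.
Qed.

Lemma bm_contentU K L :
  bm_content F (K `|` L) <= bm_content F K + bm_content F L.
Proof.
rewrite -subre_ge0 ?fin_numD ?bm_content_fin//.
have : ratio K n + ratio L n - ratio (K `|` L) n @[n --> F] -->
    bm_content F K + bm_content F L - bm_content F (K `|` L).
  apply: cvgeB; last exact: bm_cvg.
    by rewrite fin_num_adde_defl// fin_numN bm_content_fin.
  by apply: cvgeD (@bm_cvg K) (@bm_cvg L); rewrite fin_num_adde_defl// bm_content_fin.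
move/cvgF_ge; apply; apply: filterS filterT => n _.
rewrite /= subre_ge0 ?fin_numD ?rat_fin// /ratio; have [c c0 ->] := den n.
rewrite inver gt_eqF// -ge0_muleDl ?covnum_ge0//.
by rewrite lee_wpmul2r ?covnumU// lee_fin invr_ge0 ltW.
Qed.

Lemma bm_contentU_disjoint K L : closed K -> closed L -> K `&` L = set0 ->
  bm_content F K + bm_content F L <= bm_content F (K `|` L).
Proof.
move=> clK clL KL0.
have cK : compact K by apply: subclosed_compact clK cX _.
have [e e0 Hsep] := compact_sep cK clL KL0.
rewrite -subre_ge0 ?bm_content_fin//.
have : ratio (K `|` L) n - (ratio K n + ratio L n) @[n --> F] -->
    bm_content F (K `|` L) - (bm_content F K + bm_content F L).
  apply: cvgeB; first 2 last.
  - by apply: cvgeD (@bm_cvg K) (@bm_cvg L); rewrite fin_num_adde_defl// bm_content_fin.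
  - by rewrite fin_num_adde_defr// bm_content_fin.
  - exact: bm_cvg.
move/cvgF_ge; apply.
have [N _ HN] := near_infty_natSinv_lt (PosNum e0).
apply: filterS (ultra_ge FU N Fnp) => n /= /HN /= ne.
rewrite /= subre_ge0 ?rat_fin// /ratio; have [c c0 ->] := den n.
rewrite inver gt_eqF// -ge0_muleDl ?covnum_ge0//.
apply: lee_wpmul2r; first by rewrite lee_fin invr_ge0 ltW.
apply: (covnum_sep cX) => // x y Kx Ly; apply: le_trans (Hsep x y Kx Ly).
exact: ltW.
Qed.

End content.

Section outer_measure.
Context {R : realType} {X : pmetricType R} (F : set_system nat).
Context (cX : compact [set: X]).
Context (FU : UltraFilter F).
Context (Fnp : nonprincipal F).
Local Open Scope ereal_scope.
Implicit Types (A K L U V : set X).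

Lemma bm_inner_ub K U : closed K -> K `<=` U -> bm_content F K <= bm_inner F U.
Proof. by move=> cK KU; apply: ereal_sup_ubound; exists K. Qed.

Lemma bm_inner_ge0 U : 0 <= bm_inner F U.
Proof.
apply: le_trans (bm_content_ge0 cX FU set0) _.
by apply: bm_inner_ub => //; exact: closed0.
Qed.

Lemma bm_inner_le1 U : bm_inner F U <= 1.
Proof.
apply: ge_ereal_sup => _ [K _ <-].
by rewrite -(bm_contentT cX FU) le_bm_content.
Qed.

Lemma bm_inner0 : bm_inner F (@set0 X) = 0.
Proof.
apply/eqP; rewrite eq_le bm_inner_ge0 andbT.
apply: ge_ereal_sup => _ [K [_ +] <-].
by rewrite subset0 => ->; rewrite bm_content0.
Qed.

Lemma bm_inner_bigcup (U : (set X)^nat) : (forall i, open (U i)) ->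
  bm_inner F (\bigcup_i U i) <= \sum_(i <oo) bm_inner F (U i).
Proof.
move=> oU; apply: ge_ereal_sup => _ [K [clK KU] <-].
have cK : compact K by apply: subclosed_compact clK cX _.
have [n [e e0 nK]] := compact_inner_cover cK oU KU.
pose L i := K `&` [set y | ball y e `<=` U i].
have clL i : closed (L i) by apply: closedI => //; exact: closed_inner.
have LU i : L i `<=` U i by move=> x [_]; apply; exact: ballxx.
have KL : K `<=` \big[setU/set0]_(i < n) L i.
  by move=> x Kx; have [i ni xi] := nK x Kx; rewrite -bigcup_mkord; exists i.
apply: le_trans (le_bm_content cX FU KL) _.
apply: (@le_trans _ _ (\sum_(0 <= i < n) bm_inner F (U i))); last first.
  by apply: nneseries_lim_ge => i _ _; exact: bm_inner_ge0.
rewrite big_mkord; elim: (n) => [|m IH].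
  by rewrite !big_ord0 bm_content0.
rewrite !big_ord_recr/=; apply: le_trans (bm_contentU cX FU _ _) _.
by apply: leeD => //; exact: bm_inner_ub.
Qed.

Lemma bm_outer_lb A U : open U -> A `<=` U -> bm_outer F A <= bm_inner F U.
Proof. by move=> oU AU; apply: ereal_inf_lbound; exists U. Qed.

Lemma bm_outer_ge0 A : 0 <= bm_outer F A.
Proof. by apply: le_ereal_inf_tmp => _ [U _ <-]; exact: bm_inner_ge0. Qed.

Lemma bm_outer0 : bm_outer F (@set0 X) = 0.
Proof.
apply/eqP; rewrite eq_le bm_outer_ge0 andbT -bm_inner0.
by apply: bm_outer_lb => //; exact: open0.
Qed.

Lemma bm_outer_le1 A : bm_outer F A <= 1.
Proof. by apply: le_trans (bm_inner_le1 setT); apply: bm_outer_lb => //; exact: openT. Qed.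

Lemma bm_outerT : bm_outer F [set: X] = 1.
Proof.
apply/eqP; rewrite eq_le bm_outer_le1/=.
apply: le_ereal_inf_tmp => _ [U [_ TU] <-].
by rewrite -(bm_contentT cX FU) bm_inner_ub//; exact: closedT.
Qed.

Lemma bm_outer_fin A : bm_outer F A \is a fin_num.
Proof. by rewrite ge0_fin_numE ?bm_outer_ge0// (le_lt_trans (bm_outer_le1 A)) ?ltry. Qed.

Lemma le_bm_outer : {homo bm_outer F : A B / (A : set X) `<=` B >-> A <= B}.
Proof.
move=> A B AB; apply: le_ereal_inf_tmp => _ [U [oU BU] <-].
by apply: bm_outer_lb => //; exact: subset_trans BU.
Qed.

Lemma bm_outer_sigma_subadditive :
  sigma_subadditive (bm_outer F : set X -> \bar R).
Proof.
move=> A; apply/lee_addgt0Pr => e e0.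
rewrite (le_trans _ (epsilon_trick _ _ (ltW e0)))//; last first.
  by move=> n; exact: bm_outer_ge0.
pose P n U := [/\ open U, A n `<=` U &
  bm_inner F U <= bm_outer F (A n) + (e / (2 ^ n.+1)%:R)%:E].
have [U PU] : {U : (set X)^nat & forall n, P n (U n)}.
  apply: (@choice _ _ P) => n.
  have en0 : (0 < e / (2 ^ n.+1)%:R)%R by rewrite divr_gt0// ltr0n expn_gt0.
  have [_ [U [oU AU] <-] /ltW ?] := lb_ereal_inf_adherent en0 (bm_outer_fin (A n)).
  by exists U.
apply: (@le_trans _ _ (bm_inner F (\bigcup_i U i))).
  apply: bm_outer_lb.
    by apply: bigcup_open => i _; have [] := PU i.
  by apply: subset_bigcup => i _; have [] := PU i.
apply: le_trans (bm_inner_bigcup _) _; first by move=> i; have [] := PU i.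
apply: lee_nneseries => [i _ _|n _]; first exact: bm_inner_ge0.
by have [] := PU n.
Qed.

Lemma bm_outer_open A U : open U ->
  bm_outer F (A `&` U) + bm_outer F (A `&` ~` U) <= bm_outer F A.
Proof.
move=> oU; apply: le_ereal_inf_tmp => _ [V [oV AV] <-].
apply: (@le_trans _ _ (bm_inner F (V `&` U) + bm_outer F (A `&` ~` U))).
  by rewrite leeD2r// bm_outer_lb//; [exact: openI|exact: setSI].
rewrite -leeBrDr ?bm_outer_fin//; apply: ge_ereal_sup => _ [K [clK KVU] <-].
rewrite leeBrDr ?bm_outer_fin// addeC -leeBrDr ?bm_content_fin//.
apply: (@le_trans _ _ (bm_inner F (V `&` ~` K))).
  apply: bm_outer_lb; first by apply: openI => //; exact: closed_openC.
  by move=> x [/AV Vx Ux]; split => // /KVU[].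
apply: ge_ereal_sup => _ [L [clL LVK] <-].
rewrite leeBrDr ?bm_content_fin// addeC.
apply: le_trans (bm_contentU_disjoint cX FU Fnp clK clL _) _.
  by apply/seteqP; split => // x [Kx /LVK[_]].
apply: bm_inner_ub; first exact: closedU.
by move=> x [/KVU[]//|/LVK[]].
Qed.

End outer_measure.

Section measure.
Context {R : realType} {X : pmetricType R} {F : set_system nat}.
Local Open Scope ereal_scope.

Definition bm_outer_measure (cX : compact [set: X]) (FU : UltraFilter F)
  (Fnp : nonprincipal F) : set X -> \bar R := bm_outer F.

Definition bm_borel (cX : compact [set: X]) (FU : UltraFilter F)
    (Fnp : nonprincipal F) :
  set (g_sigma_algebraType (@open X)) -> \bar R := bm_outer F.

Context (cX : compact [set: X]) (FU : UltraFilter F) (Fnp : nonprincipal F).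

HB.instance Definition _ := isOuterMeasure.Build R X
  (bm_outer_measure cX FU Fnp) (bm_outer0 cX FU) (bm_outer_ge0 cX FU)
  (@le_bm_outer R X F) (bm_outer_sigma_subadditive cX FU).

Let mu : {outer_measure set X -> \bar R} := bm_outer_measure cX FU Fnp.

Lemma borel_caratheodory : <<s @open X >> `<=` mu.-caratheodory.
Proof.
apply: smallest_sub.
  split=> [|A|A].
  - exact: caratheodory_measurable_set0.
  - by rewrite setTD; exact: caratheodory_measurable_setC.
  - exact: caratheodory_measurable_bigcup.
move=> U oU; apply: le_caratheodory_measurable => A.
exact: bm_outer_open.
Qed.

Lemma bm_borel_sigma_additive : semi_sigma_additive (bm_borel cX FU Fnp).
Proof.
move=> A mA tA mbA; apply: (@caratheodory_measure_sigma_additive R X mu) => //.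
- by move=> i; exact: borel_caratheodory (mA i).
- exact: borel_caratheodory mbA.
Qed.

HB.instance Definition _ := isMeasure.Build _ _ _ (bm_borel cX FU Fnp)
  (bm_outer0 cX FU) (bm_outer_ge0 cX FU) bm_borel_sigma_additive.

HB.instance Definition _ := Measure_isProbability.Build _ _ _
  (bm_borel cX FU Fnp) (bm_outerT cX FU).

Definition bm_measure : probability (g_sigma_algebraType (@open X)) R :=
  bm_borel cX FU Fnp.

End measure.

(* Main.v *)
(** The closed thickenings [K_n] of a closed set [A] are cofinal among the
neighbourhoods of [A]: each contains an open neighbourhood of [A], and by
compactness each open neighbourhood of [A] contains some [K_n].  Hence
[mu A = lim_n lambda K_n] with no regularity assumption, so that
[sing A = mu A - lambda A]. *)
Require Import Defs.
From HB Require Import structures.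
From mathcomp Require Import all_boot all_order all_algebra lra.
From mathcomp Require Import all_classical all_reals all_analysis.

Set Implicit Arguments.
Unset Strict Implicit.
Unset Printing Implicit Defensive.

Import Order.TTheory GRing.Theory Num.Theory.
Import numFieldNormedType.Exports.

Local Open Scope classical_set_scope.
Local Open Scope ring_scope.

Section thickening.
Context {R : realType} {X : pmetricType R}.
Implicit Types A U : set X.

Lemma ball_sub_closed_thickening A (r : R) :
  \bigcup_(y in A) ball y r `<=` closed_thickening A r.
Proof.
move=> x [y Ay]; rewrite ballEmdist /= => yx.
apply: (@le_trans _ _ (mdist x y)%:E); first by apply: ereal_inf_lbound; exists y.
by rewrite lee_fin metric_sym ltW.
Qed.

Lemma le_closed_thickening A (r s : R) : r <= s ->
  closed_thickening A r `<=` closed_thickening A s.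
Proof. by move=> rs x /= /le_trans; apply; rewrite lee_fin. Qed.

(** If [x] is within [e / 2] of some [z] outside [U], the triangle inequality keeps every point of
    [A] farther than [e / 2 > r] from [x]. For [e > 0] the right-hand set is closed and lies in [U],
    so its content is at most [bm_inner F U]. *)
Lemma closed_thickening_inner A U (r e : R) : r + r < e ->
  (forall x y, A x -> (~` U) y -> e <= mdist x y) ->
  closed_thickening A r `<=` [set x | ball x (e / 2) `<=` U].
Proof.
move=> re AU x /= xA z; rewrite ballEmdist /= => xz.
apply: contrapT => Uz.
suff : ((e / 2)%:E <= r%:E)%E by rewrite lee_fin; lra.
apply: le_trans xA; apply: le_ereal_inf_tmp => _ [y Ay <-]; rewrite lee_fin.
have := AU y z Ay Uz; have := metric_triangle y x z.
rewrite (metric_sym y x); lra.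
Qed.

End thickening.

Section outer_thickening.
Context {R : realType} {X : pmetricType R} (F : set_system nat).
Context (cX : compact [set: X]) (FU : UltraFilter F).
Implicit Types A : set X.
Local Open Scope ereal_scope.

Lemma bm_outer_le_thickening A (r : R) : (0 < r)%R ->
  bm_outer F A <= bm_content F (closed_thickening A r).
Proof.
(* Closed subsets of this open neighbourhood of [A] lie in the thickening, so monotonicity of the
   content bounds the supremum defining [bm_inner]. *)
move=> r0; apply: (@le_trans _ _ (bm_inner F (\bigcup_(y in A) (ball y r)°))).
  apply: bm_outer_lb; first by apply: bigcup_open => y _; exact: open_interior.
  by move=> y Ay; exists y => //; exact: nbhsx_ballx.
apply: ge_ereal_sup => _ [K [_ KA] <-]; apply: (le_bm_content cX FU).
move=> x /KA[y Ay /interior_subset yx].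
by apply: ball_sub_closed_thickening; exists y.
Qed.

Lemma cvg_bm_content_thickening A : closed A ->
  bm_content F (closed_thickening A n.+1%:R^-1) @[n --> \oo] --> bm_outer F A.
Proof.
move=> clA; set u := fun n => _.
(* The contents are nonincreasing in [n], hence converge to the infimum of their range. *)
have -> : bm_outer F A = ereal_inf (range u).
  apply/eqP; rewrite eq_le; apply/andP; split.
    apply: le_ereal_inf_tmp => _ [n _ <-].
    by apply: bm_outer_le_thickening; rewrite invr_gt0.
  apply: le_ereal_inf_tmp => _ [U [oU AU] <-].
  have cA : compact A by exact: subclosed_compact clA cX _.
  have [||e e0 Hsep] := @compact_sep R X A (~` U) cA.
  - exact: open_closedC.
  - by apply/seteqP; split => // x [/AU].
  have e20 : (0 < e / 2)%R by rewrite divr_gt0.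
  (* With [1/(N+1) < e/2], twice the thickening radius is less than the separation [e] of [A] from
     the complement of [U]. *)
  have [N _ /(_ N (leqnn N)) /= HN] := near_infty_natSinv_lt (PosNum e20).
  apply: (@le_trans _ _ (u N)); first by apply: ereal_inf_lbound; exists N.
  (* [bm_inner] ranges over closed sets, so a closed set is inserted between the thickening and
     [U]. *)
  apply: (@le_trans _ _ (bm_content F [set x | ball x (e / 2) `<=` U])).
    apply: (le_bm_content cX FU); apply: closed_thickening_inner Hsep.
    by move: HN; set r := (_^-1)%R; lra.
  apply: bm_inner_ub; first exact: closed_inner.
  by move=> x; apply; exact: ballxx.
apply: ereal_nonincreasing_cvgn => m n mn.
apply: (le_bm_content cX FU); apply: le_closed_thickening.
by rewrite lef_pV2 ?posrE// ler_nat.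
Qed.

Lemma singularityE A : closed A ->
  singularity F A = bm_outer F A - bm_content F A.
Proof.
by move=> clA; congr (_ - _); apply/cvg_lim => //; exact: cvg_bm_content_thickening.
Qed.

End outer_thickening.

Theorem theorem5p1 (R : realType) (X : pmetricType R)
    (cX : compact [set: X]) (F : set_system nat)
    (FU : UltraFilter F) (Fnp : nonprincipal F) :
  @bm_regular R X F <->
  (forall A : set X, closed A -> bm_measure cX FU Fnp A = bm_content F A).
Proof.
split=> H A clA.
  have /eqP := H A clA; rewrite (singularityE cX FU clA).
  (* Both terms are finite, so a zero difference in the extended reals means equality; [bm_measure]
     is [bm_outer] by conversion. *)
  by rewrite sube_eq ?bm_outer_fin ?fin_num_adde_defl ?bm_content_fin ?add0e// => /eqP.
rewrite (singularityE cX FU clA) -[bm_outer F A]/(bm_measure cX FU Fnp A) H//.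
by rewrite subee ?bm_content_fin.
Qed.
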